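(* For every set $X$, the free left $h$-Ehresmann semigroup on $X$ and the free left $h$-adequate semigroup on $X$ coincide (i.e. they are isomorphic as $(2,1)$-algebras via an isomorphism which is the identity on $X$).
   Context: A semigroup $S$ with a unary operation ${}^+$ is left Ehresmann if $x^+x=x$, $(x^+y^+)^+=x^+y^+=y^+x^+$ and $(xy)^+=(xy^+)^+$ for all $x,y\in S$. It is left adequate if it is left Ehresmann and moreover $x^2=x$ implies $x=x^+$, and $xz=yz$ implies $xz^+=yz^+$, for all $x,y,z\in S$. The left $h$ condition is: $(xz^+y)^+=(xy)^+(xz)^+$ for all $x,y,z\in S$. A left Ehresmann [resp. left adequate] semigroup satisfying the left $h$ condition is called left $h$-Ehresmann [resp. left $h$-adequate]. These are regarded as $(2,1)$-algebras (product, ${}^+$); morphisms preserve both operations. For a class $\mathcal{C}$ of algebras of common signature, the free object of $\mathcal{C}$ on a set $X$ is an algebra $F\in\mathcal{C}$ containing $X$ such that for every $M\in\mathcal{C}$ every function $X\to M$ extends to a unique morphism $F\to M$; it exists for each of the two classes above and is unique up to isomorphism. (The empty semigroup is permitted; it is the free object on $X=\emptyset$.) *)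

(* Defs.v *)
From HB Require Import structures.
From mathcomp Require Import all_boot.

Set Implicit Arguments.
Unset Strict Implicit.
Unset Printing Implicit Defensive.

Local Open Scope group_scope.

HB.mixin Record hasPlus S := { plus : S -> S }.

(* (2,1)-algebras.  The base is magmaType and not semigroupType because the
   latter requires a choiceType carrier; associativity is part of
   left_Ehresmann below.  The carrier may be empty. *)
#[short(type="plusMagmaType")]
HB.structure Definition PlusMagma := {S of hasPlus S & Magma S}.

Notation "x ^(+)" := (plus x) (at level 2, left associativity, format "x ^(+)")
  : group_scope.

Record left_Ehresmann (S : plusMagmaType) : Prop := LeftEhresmann {
  le_mulA : associative (@mul S);
  le_plus_mul : forall x : S, x^(+) * x = x;
  le_plus_plusM : forall x y : S, (x^(+) * y^(+))^(+) = x^(+) * y^(+);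
  le_plusC : forall x y : S, x^(+) * y^(+) = y^(+) * x^(+);
  le_plusM : forall x y : S, (x * y)^(+) = (x * y^(+))^(+)
}.

Record left_adequate (S : plusMagmaType) : Prop := LeftAdequate {
  la_left_Ehresmann : left_Ehresmann S;
  la_idem : forall x : S, x * x = x -> x = x^(+);
  la_cancel : forall x y z : S, x * z = y * z -> x * z^(+) = y * z^(+)
}.

Definition left_h_condition (S : plusMagmaType) : Prop :=
  forall x y z : S, (x * z^(+) * y)^(+) = (x * y)^(+) * (x * z)^(+).

Definition left_h_Ehresmann (S : plusMagmaType) : Prop :=
  left_Ehresmann S /\ left_h_condition S.

Definition left_h_adequate (S : plusMagmaType) : Prop :=
  left_adequate S /\ left_h_condition S.

Definition plus_morphism (S T : plusMagmaType) (f : S -> T) : Prop :=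
  {morph f : x y / x * y} /\ {morph f : x / x^(+)}.

(* F contains X through the injection i. *)
Record free_on (C : plusMagmaType -> Prop) (X : Type)
    (F : plusMagmaType) (i : X -> F) : Prop := FreeOn {
  free_mem : C F;
  free_inj : injective i;
  free_ext : forall M : plusMagmaType, C M -> forall g : X -> M,
    exists f : F -> M, [/\ plus_morphism f, forall x, f (i x) = g x
      & forall f' : F -> M,
          plus_morphism f' -> (forall x, f' (i x) = g x) -> f' =1 f]
}.

(* Main.v *)
(** In a left h-Ehresmann semigroup the projection [x^+] of a product only
    depends on the words read along the branches of the tree of [x], so every
    element is a trunk [a1 ... an] decorated at each of its vertices with a
    finite set of words.  The algebra of trunks decorated with arbitrary sets
    of words is left h-adequate, because a product [x z] displays all of
    [x z^+].  The free left h-Ehresmann semigroup embeds into it: an element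
    can be recovered from its decorated trunk.  Left adequacy is inherited by
    subalgebras, so the free left h-Ehresmann semigroup is left adequate. *)
From HB Require Import structures.
Require Import Defs.
From mathcomp Require Import all_boot.
From mathcomp Require Import boolp classical_sets.
From Stdlib Require List.

Set Implicit Arguments.
Unset Strict Implicit.
Unset Printing Implicit Defensive.

Local Open Scope group_scope.

(** * Morphisms, subalgebras and induction over a free object *)

Lemma plus_morphism_comp (S T U : plusMagmaType) (f : S -> T) (g : T -> U) :
  plus_morphism f -> plus_morphism g -> plus_morphism (g \o f).
Proof.
by move=> [fM fP] [gM gP]; split=> [x y|x] /=; rewrite ?fM ?gM ?fP ?gP.
Qed.

Lemma left_h_Ehresmann_inj (S T : plusMagmaType) (f : S -> T) :
  plus_morphism f -> injective f -> left_h_Ehresmann T -> left_h_Ehresmann S.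
Proof.
move=> [fM fP] f_inj [[mA pm ppM pC pM] h].
split; first split.
- by move=> x y z; apply: f_inj; rewrite !fM mA.
- by move=> x; apply: f_inj; rewrite fM fP pm.
- by move=> x y; apply: f_inj; rewrite !(fM, fP) ppM.
- by move=> x y; apply: f_inj; rewrite !(fM, fP) pC.
- by move=> x y; apply: f_inj; rewrite !(fM, fP) pM.
- by move=> x y z; apply: f_inj; rewrite !(fM, fP) h.
Qed.

(** All the axioms are identities or quasi-identities, so they pull back along embeddings. *)
Lemma left_h_adequate_inj (S T : plusMagmaType) (f : S -> T) :
  plus_morphism f -> injective f -> left_h_adequate T -> left_h_adequate S.
Proof.
move=> f_mor f_inj [[TE idem canc] h].
have [SE Sh] := left_h_Ehresmann_inj f_mor f_inj (conj TE h).
have [fM fP] := f_mor.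
split=> //; split=> // [x xx|x y z xzyz]; apply: f_inj.
  by rewrite fP -idem // -fM xx.
by rewrite !fM fP; apply: canc; rewrite -!fM xzyz.
Qed.

Section Subalgebra.
Context (S : plusMagmaType) (P : S -> Prop).

(** The closure proofs are phantom arguments, so that both operations can be attached to the type
    itself. *)
Definition subalgebra
  (_ : forall x y, P x -> P y -> P (x * y)) (_ : forall x, P x -> P x^(+)) :=
  {x | P x}.

Context (PM : forall x y, P x -> P y -> P (x * y)).
Context (PP : forall x, P x -> P x^(+)).

HB.instance Definition _ := hasMul.Build (subalgebra PM PP)
  (fun x y => exist P _ (PM (svalP x) (svalP y))).
HB.instance Definition _ := hasPlus.Build (subalgebra PM PP)
  (fun x => exist P _ (PP (svalP x))).

End Subalgebra.

(** The elements satisfying [P] form a subalgebra in the class. The map into it given by freeness,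
    followed by the inclusion, fixes the generators, hence is the identity by uniqueness. *)
Lemma free_ind (C : plusMagmaType -> Prop) (X : Type) (F : plusMagmaType)
    (i : X -> F) (P : F -> Prop) :
  (forall (S T : plusMagmaType) (f : S -> T),
     plus_morphism f -> injective f -> C T -> C S) ->
  free_on C i -> (forall x, P (i x)) ->
  (forall x y, P x -> P y -> P (x * y)) -> (forall x, P x -> P x^(+)) ->
  forall x, P x.
Proof.
move=> C_inj [CF _ ext] Pi PM PP x.
pose v (y : subalgebra PM PP) : F := sval y.
have v_mor : plus_morphism v by [].
have v_inj : injective v.
  by move=> [y Py] [z Pz]; rewrite /v /= => yz; apply: eq_exist.
have [f [f_mor fi _]] := ext _ (C_inj _ _ _ v_mor v_inj CF)
  (fun x => exist P _ (Pi x) : subalgebra PM PP).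
have [k [_ _ k_uniq]] := ext F CF i.
have -> : x = v (f x).
  have vf_k : v \o f =1 k.
    by apply: k_uniq; [exact: plus_morphism_comp | move=> y; rewrite /= fi].
  by rewrite -[v (f x)]/((v \o f) x) vf_k; apply: (k_uniq id).
exact: svalP (f x).
Qed.

(** * Adjoining an identity, the value of empty words and empty products *)

Definition adjoin1 (S : Type) := option S.

Section Adjoin1.
Context (S : plusMagmaType).

Definition adjoin1_mul (x y : adjoin1 S) : adjoin1 S :=
  match x, y with
  | Some a, Some b => Some (a * b)
  | Some a, None => Some a
  | None, _ => y
  end.

HB.instance Definition _ := hasMul.Build (adjoin1 S) adjoin1_mul.
HB.instance Definition _ :=
  hasPlus.Build (adjoin1 S) (omap (@plus S)).

Lemma adjoin1_left_h_Ehresmann :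
  left_h_Ehresmann S -> left_h_Ehresmann (adjoin1 S).
Proof.
move=> [[mA pm ppM pC pM] h].
have pid (x : S) : x^(+) * x^(+) = x^(+) by rewrite -ppM -pM pm.
have pp (x : S) : (x^(+))^(+) = x^(+) by rewrite -[in LHS](pid x) ppM pid.
have ple (x y : S) : (x * y)^(+) * x^(+) = (x * y)^(+).
  by rewrite pC -[in RHS](pm x) -mA (pM x^(+)) ppM.
split; first split.
- by move=> [x|] [y|] [z|] //; rewrite /mul /= mA.
- by move=> [x|] //; rewrite /mul /= pm.
- by move=> [x|] [y|] //; rewrite /mul /plus /= ?ppM ?pp.
- by move=> [x|] [y|] //; rewrite /mul /plus /= pC.
- by move=> [x|] [y|] //; rewrite /mul /plus /= ?pp // pM.
(* For [x] in [S] and exactly one of [y], [z] the identity, the condition amounts to [ple]. *)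
move=> [x|] [y|] [z|] //; rewrite /mul /plus /=; congr Some.
- exact: h.
- by rewrite ple.
- by rewrite -pM pC ple.
- by rewrite pid.
- by rewrite pM ppM pC.
- by rewrite pp.
Qed.

End Adjoin1.

(** * Products of decorated trunks *)

Section DecoratedTrunks.
Context (X P : Type) (join : P -> P -> P) (shift : X -> P -> P).

(* [(A, [:: (a1, A1); ...; (an, An)])] is the trunk [a1 ... an] whose initial
   vertex is decorated with [A] and whose [k]-th next vertex with [Ak]. *)
Definition trunk : Type := P * seq (X * P).

(** The end of the left trunk is glued to the start of [v]. Decorations are then updated backwards:
    each vertex gains the new decoration of the next one, shifted by the letter in between. *)
Fixpoint graft (A : P) (l : seq (X * P)) (v : trunk) : trunk :=
  if l is (a, C) :: l' then
    let u := graft C l' v in (join A (shift a u.1), (a, u.1) :: u.2)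
  else (join A v.1, v.2).

Definition trunk_mul (u v : trunk) : trunk := graft u.1 u.2 v.

End DecoratedTrunks.

Section TrunkMorphism.
Context (X P Q : Type) (jP : P -> P -> P) (sP : X -> P -> P).
Context (jQ : Q -> Q -> Q) (sQ : X -> Q -> Q) (f : P -> Q).

Definition trunk_map (u : trunk X P) : trunk X Q :=
  (f u.1, [seq (p.1, f p.2) | p <- u.2]).

Lemma trunk_map_mul :
  {morph f : A B / jP A B >-> jQ A B} ->
  (forall a, {morph f : A / sP a A >-> sQ a A}) ->
  {morph trunk_map : u v / trunk_mul jP sP u v >-> trunk_mul jQ sQ u v}.
Proof.
move=> fj fs [A l] v; rewrite /trunk_mul /=.
elim: l A => [|[a C] l IH] A /=; first by rewrite /trunk_map /= fj.
by rewrite -IH /trunk_map /= fj fs.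
Qed.

End TrunkMorphism.

(** * Trunks decorated with arbitrary sets of words *)

Section LanguageTrunks.
Local Open Scope classical_set_scope.
Context (X : Type).

Definition ltrunk : Type := trunk X (set (seq X)).

Definition lgraft := graft (@setU (seq X)) (fun a => image^~ (cons a)).

HB.instance Definition _ := hasMul.Build ltrunk
  (trunk_mul (@setU (seq X)) (fun a => image^~ (cons a))).
HB.instance Definition _ :=
  hasPlus.Build ltrunk (fun u => (u.1, [::])).

Lemma lgraft_sub A l v : A `<=` (lgraft A l v).1.
Proof. by case: l => [|[a C] l] /=; apply: subsetUl. Qed.

Lemma lgraft_size A l v : size (lgraft A l v).2 = (size l + size v.2)%N.
Proof. by elim: l A => [|[a C] l IH] A //=; rewrite IH. Qed.

Lemma lgraft1 A l v w : v.1 = w.1 -> (lgraft A l v).1 = (lgraft A l w).1.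
Proof. by move=> vw; elim: l A => [|[a C] l IH] A /=; rewrite ?vw ?IH. Qed.

(** Shifts preserve unions, and the contributions of [A] and [l], doubled on the right, merge by
    idempotence. This yields the left h condition. *)
Lemma lgraftU A l B C m n p :
  (lgraft A l (B `|` C, m)).1 = (lgraft A l (C, n)).1 `|` (lgraft A l (B, p)).1.
Proof.
elim: l A => [|[a D] l IH] A /=; first by rewrite setUACA setUid [C `|` B]setUC.
by rewrite IH image_setU setUACA setUid.
Qed.

Lemma lgraftA A l v w :
  lgraft A l (lgraft v.1 v.2 w) =
  lgraft (lgraft A l v).1 (lgraft A l v).2 w.
Proof.
elim: l A => [|[a C] l IH] A /=.
  by case: v => B [|[b D] m] /=; rewrite setUA.
rewrite IH -setUA -image_setU; congr (_ `|` _ @` _, _).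
(* Multiplying further by [w] only enlarges the decoration left by [v], so shifting both adds
   nothing. *)
by rewrite setUidr //; apply: lgraft_sub.
Qed.

(** Counting letters, [l] and [m] have equal length, so the two products can be compared vertex by
    vertex; the decorations along the left factor depend on [v] only through [v.1]. *)
Lemma lgraft_cancel A l B m v : lgraft A l v = lgraft B m v ->
  lgraft A l (v.1, [::]) = lgraft B m (v.1, [::]).
Proof.
have fst C n : (lgraft C n v).1 = (lgraft C n (v.1, [::])).1 by exact: lgraft1.
move=> E; have /eqP : size (lgraft A l v).2 = size (lgraft B m v).2.
  by rewrite E.
rewrite !lgraft_size eqn_add2r.
elim: l m A B E => [|[a C] l IH] [|[b D] m] A B //=; first by case=> ->.
move=> [AB ab CD lm] szE; rewrite -/lgraft -ab in AB CD lm *.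
rewrite (IH m C D) // -?fst; last first.
  rewrite (surjective_pairing (lgraft C _ _)).
  by rewrite (surjective_pairing (lgraft D _ _)) CD lm.
by congr pair; move: AB; rewrite /= CD.
Qed.

Lemma ltrunk_left_h_adequate : left_h_adequate ltrunk.
Proof.
have mulE (u v : ltrunk) : u * v = lgraft u.1 u.2 v by [].
have plusE (u : ltrunk) : u^(+) = (u.1, [::]) by [].
split; first split; first split.
- by move=> u v w; rewrite !mulE lgraftA.
- by move=> [A l]; rewrite mulE plusE /= setUid.
- by move=> u v; rewrite !mulE !plusE.
- by move=> u v; rewrite !mulE !plusE /= setUC.
- by move=> u v; rewrite !mulE !plusE (lgraft1 _ _ (w := v^(+))).
(* Lengths add up in a product, so the trunk of an idempotent is empty. *)
- move=> [A l]; rewrite mulE plusE => /(congr1 (fun u => size u.2)) /eqP.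
  by rewrite lgraft_size -[X in _ == X]addn0 eqn_add2l => /nilP /= ->.
- by move=> u v w; rewrite !mulE; apply: lgraft_cancel.
move=> [A l] [B m] [C n]; rewrite !mulE !plusE -lgraftA; congr pair.
exact: lgraftU.
Qed.

End LanguageTrunks.

(** * Finitely decorated trunks and their evaluation *)

Section FiniteTrunks.
Context (X : Type).

(** Lists instead of sets allow evaluation by recursion; [eval_languages] shows that the choice of
    list does not matter. *)
Definition ftrunk : Type := trunk X (seq (seq X)).

Definition fgraft := graft (@cat (seq X)) (fun a => map (cons a)).

Definition ftrunk_mul : ftrunk -> ftrunk -> ftrunk :=
  trunk_mul (@cat (seq X)) (fun a => map (cons a)).

Definition language (L : seq (seq X)) : set (seq X) :=
  [set w | List.In w L]%classic.

Definition languages : ftrunk -> ltrunk X := trunk_map language.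

Lemma languages_mul u v :
  languages (ftrunk_mul u v) = languages u * languages v.
Proof.
apply: trunk_map_mul => [A B|a A]; apply/seteqP.
  by split=> w /List.in_app_iff.
split=> [w /List.in_map_iff[z [<- Az]]|w [z Az <-]]; first by exists z.
by apply/List.in_map_iff; exists z.
Qed.

(* The words readable from a vertex along the trunk belong to its decoration. *)
Fixpoint saturated (A : seq (seq X)) (l : seq (X * seq (seq X))) : Prop :=
  if l is (a, C) :: l' then
    [/\ List.In [:: a] A, List.incl (map (cons a) C) A & saturated C l']
  else True.

Lemma saturated_graft A l v : saturated A l -> saturated v.1 v.2 ->
  saturated (fgraft A l v).1 (fgraft A l v).2.
Proof.
move=> Al vs; elim: l A Al => [|[a C] l IH] A /=.
  move=> _; case: v vs => B [|[b D] m] //= [bB DB ms]; split=> //.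
    by apply/List.in_or_app; right.
  exact: List.incl_appr.
move=> [aA CA /IH Cl]; split=> //; first by apply/List.in_or_app; left.
exact/List.incl_appr/List.incl_refl.
Qed.

Section Evaluation.
Context (T : plusMagmaType) (one : T) (g : X -> T).
Context (TE : left_h_Ehresmann T) (one_plus : one^(+) = one).
Context (one_mul : forall x : T, one * x = x).
Context (mul_one : forall x : T, x * one = x).

Let mA := le_mulA (proj1 TE).
Let pm := le_plus_mul (proj1 TE).
Let ppM := le_plus_plusM (proj1 TE).
Let pC := le_plusC (proj1 TE).
Let pM := le_plusM (proj1 TE).
Let h := proj2 TE.

Definition word (w : seq X) : T := foldr (fun a t => g a * t) one w.

Definition proj (L : seq (seq X)) : T :=
  foldr (fun w t => (word w)^(+) * t) one L.

Definition tail (l : seq (X * seq (seq X))) : T :=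
  foldr (fun p t => g p.1 * (proj p.2 * t)) one l.

Definition eval (u : ftrunk) : T := proj u.1 * tail u.2.

Let plusK (x : T) : (x^(+))^(+) = x^(+).
Proof. by have := pM one x; rewrite !one_mul. Qed.

Lemma proj_plus L : (proj L)^(+) = proj L.
Proof. by elim: L => //= w L IH; rewrite -IH ppM. Qed.

Lemma projC A B : proj A * proj B = proj B * proj A.
Proof. by rewrite -(proj_plus A) -(proj_plus B) pC. Qed.

Lemma proj_id A : proj A * proj A = proj A.
Proof. by rewrite -{1}proj_plus pm. Qed.

Lemma proj_cat A B : proj (A ++ B) = proj A * proj B.
Proof. by elim: A => [|w A IH] /=; rewrite ?one_mul // IH mA. Qed.

Lemma proj_in w L : List.In w L -> (word w)^(+) * proj L = proj L.
Proof.
elim: L => //= z L IH [->|/IH wL]; first by rewrite mA -{1}(plusK (word w)) pm.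
by rewrite mA (pC (word w)) -mA wL.
Qed.

Lemma proj_incl A B : List.incl A B -> proj A * proj B = proj B.
Proof.
elim: A => [|w A IH] /= AB; first by rewrite one_mul.
rewrite -mA IH; first by apply: proj_in; apply: AB; left.
by move=> z zA; apply: AB; right.
Qed.

Lemma proj_language A B : language A = language B -> proj A = proj B.
Proof.
move=> /seteqP[AB BA].
by rewrite -(proj_incl AB) projC (proj_incl BA).
Qed.

(** The left h condition, with [g a], [proj C] and [word w] for [x], [y] and [z], splits off one
    word at a time. *)
Lemma mul_proj_plus a C :
  (g a * proj C)^(+) = proj (map (cons a) C) * (g a)^(+).
Proof.
elim: C => [|w C IH] /=; first by rewrite mul_one one_mul.
by rewrite (mA (g a)) h pC IH mA.
Qed.

(** An element is fixed by its own [plus], and that of [g a * proj C] has the shifted projections as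
    a factor. Hence the words that [graft] copies to earlier vertices do not change the value. *)
Lemma proj_shift_absorb a C t :
  proj (map (cons a) C) * (g a * (proj C * t)) = g a * (proj C * t).
Proof.
by rewrite [g a * _]mA -(pm (g a * proj C)) mul_proj_plus !mA proj_id.
Qed.

Lemma eval_mul : {morph eval : u v / ftrunk_mul u v >-> u * v}.
Proof.
move=> [A l] v; rewrite /ftrunk_mul /trunk_mul -/fgraft /=.
elim: l A => [|[a C] l IH] A; first by rewrite /eval /= proj_cat mul_one mA.
rewrite /eval /= proj_cat -mA proj_shift_absorb -/fgraft.
have := IH C; rewrite /eval /= => ->.
by rewrite !mA.
Qed.

(** By saturation, the projections [(g a)^(+)] and [proj (map (cons a) C)] coming from the first
    edge are absorbed by [proj A]. *)
Lemma eval_plus A l : saturated A l -> (eval (A, l))^(+) = proj A.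
Proof.
elim: l A => [|[a C] l IH] A; first by rewrite /eval /= mul_one proj_plus.
move=> [aA CA Cl]; rewrite /eval /= pM (pM (g a)) (IH _ Cl : (_ * _)^(+) = _).
rewrite mul_proj_plus mA (projC A) (proj_incl CA).
have := proj_in aA; rewrite /= mul_one -{1}proj_plus -pC proj_plus => ->.
exact: proj_plus.
Qed.

Lemma eval_languages u v : languages u = languages v -> eval u = eval v.
Proof.
case: u v => A l [B m] [/proj_language AB lm]; rewrite /eval /= AB.
congr mul; elim: l m lm => [|[a C] l IH] [|[b D] m] //=.
by move=> [-> /proj_language -> /IH ->].
Qed.

End Evaluation.
End FiniteTrunks.

(** * Adequacy of the free object and comparison of the two free objects *)

Lemma free_left_h_Ehresmann_adequate (X : Type) (F : plusMagmaType)
  (i : X -> F) : free_on left_h_Ehresmann i -> left_h_adequate F.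
Proof.
move=> freeF; have [FE _ ext] := freeF.
have LA := ltrunk_left_h_adequate X.
(* The word [[:: x]] at the initial vertex makes this saturated; the value is [(i x)^(+) * i x],
   that is [i x]. *)
pose gen x : ftrunk X := ([:: [:: x]], [:: (x, [::])]).
have [p [p_mor p_gen _]] := ext (ltrunk X) (conj (la_left_Ehresmann LA.1) LA.2)
  (fun x => languages (gen x)).
have [pMul pPlus] := p_mor.
have TE := adjoin1_left_h_Ehresmann FE.
pose one : adjoin1 F := None.
have one_mul (x : adjoin1 F) : one * x = x by [].
have mul_one (x : adjoin1 F) : x * one = x by case: x.
pose g x : adjoin1 F := Some (i x).
pose ev := eval one g.
(* Saturation is carried along because the [plus] case relies on [eval_plus]. *)
have decomp f : exists u,
  [/\ saturated u.1 u.2, languages u = p f & ev u = Some f].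
  move: f; apply: (free_ind left_h_Ehresmann_inj freeF).
  - move=> x; exists (gen x); split; first by split=> //; left.
      by rewrite p_gen.
    exact: (congr1 Some (le_plus_mul FE.1 (i x))).
  - move=> x y [u [us up ue]] [v [vs vp ve]]; exists (ftrunk_mul u v); split.
    + exact: saturated_graft.
    + by rewrite languages_mul up vp pMul.
    + by rewrite /ev eval_mul // -/ev ue ve.
  - move=> x [[A l] [us up ue]]; exists (A, [::]); split=> //.
      by rewrite pPlus -up.
    rewrite -[Some _]/(Some x : adjoin1 F)^(+) -ue /ev eval_plus //.
    by rewrite /eval mul_one.
(* The image under [p] determines the value of any finite representative, hence the element: [p] is
   injective. *)
apply: (left_h_adequate_inj p_mor _ LA) => x y.
have [u [_ <- ue]] := decomp x; have [v [_ <- ve]] := decomp y.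
have ev_inj := eval_languages g TE (erefl : one^(+) = one) one_mul.
by move=> /ev_inj; rewrite -/(ev u) -/(ev v) ue ve => -[].
Qed.

Theorem corollary5p3 (X : Type)
    (F : plusMagmaType) (i : X -> F) (G : plusMagmaType) (j : X -> G) :
  free_on left_h_Ehresmann i -> free_on left_h_adequate j ->
  exists phi : F -> G,
    [/\ plus_morphism phi, bijective phi & forall x : X, phi (i x) = j x].
Proof.
move=> freeF freeG; have FA := free_left_h_Ehresmann_adequate freeF.
have [FE _ extF] := freeF; have [GA _ extG] := freeG.
have [phi [phi_mor phi_i _]] := extF G (conj (la_left_Ehresmann GA.1) GA.2) j.
(* Adequacy of [F] makes it an admissible target for the freeness of [G]. *)
have [psi [psi_mor psi_j _]] := extG F FA i.
exists phi; split=> //; exists psi => x.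
  have [k [_ _ k_uniq]] := extF F FE i.
  transitivity (k x); last by symmetry; apply: (k_uniq id).
  apply: (k_uniq (psi \o phi)); first exact: plus_morphism_comp.
  by move=> y; rewrite /= phi_i psi_j.
have [k [_ _ k_uniq]] := extG G GA j.
transitivity (k x); last by symmetry; apply: (k_uniq id).
apply: (k_uniq (phi \o psi)); first exact: plus_morphism_comp.
by move=> y; rewrite /= psi_j phi_i.
Qed.
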